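(* Let $(A,[\cdot,\cdot])$ be a left-Alia algebra and $r\in A\otimes A$. Suppose that $r$ is an antisymmetric solution of the left-Alia Yang-Baxter equation, that is, $r+\tau(r)=0$ and $\mathrm{Al}(r)=0$. Then $(A,[\cdot,\cdot],\delta_r)$ is a left-Alia bialgebra, where $\delta_r:A\to A\otimes A$ is given by $$\delta_r(x)=\big((\mathcal R-\mathcal L)(x)\otimes\mathrm{id}-\mathrm{id}\otimes\mathcal R(x)\big)r,\qquad\forall x\in A.$$
   Context: All vector spaces are finite-dimensional over an algebraically closed field $\mathbb K$ of characteristic zero. A left-Alia algebra is a vector space $A$ with a bilinear map $[\cdot,\cdot]:A\times A\to A$ (not assumed antisymmetric) such that for all $x,y,z\in A$ $$[[x,y],z]+[[y,z],x]+[[z,x],y]=[[y,x],z]+[[z,y],x]+[[x,z],y].$$ $\mathcal L,\mathcal R:A\to\mathrm{End}(A)$ are given by $\mathcal L(x)y=[x,y]=\mathcal R(y)x$. Let $\tau(x\otimes y)=y\otimes x$ and $\xi(x\otimes y\otimes z)=y\otimes z\otimes x$. For $r=\sum_i u_i\otimes v_i\in A\otimes A$, $$\mathrm{Al}(r)=\sum_{i,j}\Big([u_i,u_j]\otimes v_i\otimes v_j+u_i\otimes([u_j,v_i]-[v_i,u_j])\otimes v_j-u_i\otimes u_j\otimes[v_j,v_i]\Big)\in A^{\otimes 3}.$$ A left-Alia coalgebra is a pair $(A,\delta)$ with $A$ a vector space and $\delta:A\to A\otimes A$ linear such that $(\mathrm{id}^{\otimes3}+\xi+\xi^2)(\tau\otimes\mathrm{id}-\mathrm{id}^{\otimes3})(\delta\otimes\mathrm{id})\delta=0$.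 A left-Alia bialgebra is a triple $(A,[\cdot,\cdot],\delta)$ such that $(A,[\cdot,\cdot])$ is a left-Alia algebra, $(A,\delta)$ is a left-Alia coalgebra and, for all $x,y\in A$, $$(\tau-\mathrm{id}^{\otimes 2})\Big(\delta([x,y]-[y,x])+(\mathcal R(x)\otimes\mathrm{id})\delta(y)-(\mathcal R(y)\otimes\mathrm{id})\delta(x)\Big)=0.$$ *)

(* Defs.v *)
From HB Require Import structures.
From mathcomp Require Import all_boot all_order all_algebra.

Set Implicit Arguments.
Unset Strict Implicit.
Unset Printing Implicit Defensive.

Import GRing.Theory.
Local Open Scope ring_scope.

(* U (x) V is realized by the matrices of coordinates in the bases vbasis {:U}
   and vbasis {:V}. The lemmas tens_is_bilinear, tliftE, tens_span and tens_ext
   below are its universal property. *)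
Definition tens (K : fieldType) (U V : vectType K) : Type :=
  'M[K]_(\dim {:U}, \dim {:V}).

HB.instance Definition _ (K : fieldType) (U V : vectType K) :=
  Vector.copy (tens U V) 'M[K]_(\dim {:U}, \dim {:V}).

Definition tpure (K : fieldType) (U V : vectType K) (u : U) (v : V) :
  tens U V :=
  \matrix_(i, j) (coord (vbasis {:U}) i u * coord (vbasis {:V}) j v).

Notation "u ⊗ v" := (tpure u v) (at level 40, left associativity) : ring_scope.

(* The linear map induced by a bilinear f. It is linear for every f, but the
   equation tlift f (u ⊗ v) = f u v needs f to be bilinear. *)
Definition tlift (K : fieldType) (U V W : vectType K) (f : U -> V -> W) :
  'Hom(tens U V, W) :=
  linfun (fun t : tens U V =>
    \sum_i \sum_j t i j *: f (vbasis {:U})`_i (vbasis {:V})`_j).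

Definition tmap (K : fieldType) (U V U' V' : vectType K)
  (f : U -> U') (g : V -> V') : 'Hom(tens U V, tens U' V') :=
  tlift (fun u v => f u ⊗ g v).

Definition tens3 (K : fieldType) (A : vectType K) : vectType K :=
  tens (tens A A) A.

Definition tau (K : fieldType) (A : vectType K) : 'End(tens A A) :=
  tlift (fun x y : A => y ⊗ x).

Definition xi (K : fieldType) (A : vectType K) : 'End(tens3 A) :=
  tlift (fun (t : tens A A) (z : A) =>
    tlift (fun x y : A => (y ⊗ z ⊗ x : tens3 A)) t).

Definition left_alia_algebra (K : fieldType) (A : vectType K)
  (br : {bilinear A -> A -> A}) : Prop :=
  forall x y z : A,
    br (br x y) z + br (br y z) x + br (br z x) y
    = br (br y x) z + br (br z y) x + br (br x z) y.

Definition Lmul (K : fieldType) (A : vectType K) (br : {bilinear A -> A -> A})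
  (x : A) : 'End(A) := linfun (fun y => br x y).

Definition Rmul (K : fieldType) (A : vectType K) (br : {bilinear A -> A -> A})
  (x : A) : 'End(A) := linfun (fun y => br y x).

Definition Al_term (K : fieldType) (A : vectType K)
  (br : {bilinear A -> A -> A}) (u v u' v' : A) : tens3 A :=
  br u u' ⊗ v ⊗ v' + u ⊗ (br u' v - br v u') ⊗ v' - u ⊗ u' ⊗ br v' v.

(* For r = \sum_i u_i ⊗ v_i this is \sum_(i, j) Al_term br u_i v_i u_j v_j
   whatever the decomposition of r: see Al_sum. *)
Definition Al (K : fieldType) (A : vectType K) (br : {bilinear A -> A -> A})
  (r : tens A A) : tens3 A :=
  tlift (fun u v : A => tlift (fun u' v' : A => Al_term br u v u' v') r) r.

Definition left_alia_coalgebra (K : fieldType) (A : vectType K)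
  (delta : A -> tens A A) : Prop :=
  linear delta /\
  forall x : A,
    ((\1 + xi A + (xi A \o xi A)) \o (tmap (tau A) (@idfun A) - \1)
       \o tmap delta (@idfun A))%VF (delta x) = 0.

Definition left_alia_bialgebra (K : fieldType) (A : vectType K)
  (br : {bilinear A -> A -> A}) (delta : A -> tens A A) : Prop :=
  [/\ left_alia_algebra br,
      left_alia_coalgebra delta
    & forall x y : A,
        (tau A - \1)%VF
          (delta (br x y - br y x) + tmap (Rmul br x) (@idfun A) (delta y)
           - tmap (Rmul br y) (@idfun A) (delta x)) = 0].

Definition delta_r (K : fieldType) (A : vectType K)
  (br : {bilinear A -> A -> A}) (r : tens A A) (x : A) : tens A A :=
  (tmap (Rmul br x - Lmul br x) (@idfun A) - tmap (@idfun A) (Rmul br x))%VF r.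

Lemma tens_is_bilinear (K : fieldType) (U V : vectType K) :
  bilinear_for (GRing.Scale.Law.clone _ _ *:%R _)
    (GRing.Scale.Law.clone _ _ *:%R _) (@tpure K U V).
Proof.
split=> [v a u u' | u a v v'] /=; apply/matrixP=> i j; rewrite !mxE linearP /=.
  by rewrite mulrDl mulrA.
by rewrite mulrDr mulrCA.
Qed.

HB.instance Definition _ (K : fieldType) (U V : vectType K) :=
  bilinear_isBilinear.Build K U V (tens U V) _ _ (@tpure K U V)
    (tens_is_bilinear U V).

Lemma tlift_coordE (K : fieldType) (U V W : vectType K) (f : U -> V -> W)
  (t : tens U V) :
  tlift f t = \sum_i \sum_j t i j *: f (vbasis {:U})`_i (vbasis {:V})`_j.
Proof.
pose g (t : tens U V) :=
  \sum_i \sum_j t i j *: f (vbasis {:U})`_i (vbasis {:V})`_j.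
have gP : linear g.
  move=> a x y; rewrite /g scaler_sumr -big_split /=; apply: eq_bigr => i _.
  rewrite scaler_sumr -big_split /=; apply: eq_bigr => j _.
  by rewrite !mxE scalerDl scalerA.
pose gL := GRing.isLinear.Build K (tens U V) W *:%R g gP.
pose G : {linear tens U V -> W} := HB.pack g gL.
exact: (lfunE G t).
Qed.

Lemma tliftE (K : fieldType) (U V W : vectType K) (f : U -> V -> W)
  (f_lin : bilinear_for (GRing.Scale.Law.clone _ _ *:%R _)
    (GRing.Scale.Law.clone _ _ *:%R _) f) (u : U) (v : V) :
  tlift f (u ⊗ v) = f u v.
Proof.
have tliftF (F : {bilinear U -> V -> W}) : tlift F (u ⊗ v) = F u v.
  rewrite tlift_coordE [in RHS](coord_vbasis (memvf u)).
  rewrite [in RHS](coord_vbasis (memvf v)) linear_sumlz /=.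
  apply: eq_bigr => i _; rewrite linear_sumr /=; apply: eq_bigr => j _.
  by rewrite linearZl_LR linearZr_LR scalerA mxE.
exact: (tliftF (HB.pack f (bilinear_isBilinear.Build K U V W _ _ f f_lin))).
Qed.

Lemma tens_span (K : fieldType) (U V : vectType K) (t : tens U V) :
  t = \sum_i \sum_j t i j *: ((vbasis {:U})`_i ⊗ (vbasis {:V})`_j).
Proof.
apply/matrixP=> k l; rewrite summxE (bigD1 k) //= summxE (bigD1 l) //= !mxE.
rewrite !coord_free ?(basis_free (vbasisP _)) // !eqxx !mulr1 !big1 ?addr0 //.
  move=> i /negPf ik; rewrite summxE big1 // => j _; rewrite !mxE.
  by rewrite coord_free ?(basis_free (vbasisP _)) // ik mul0r mulr0.
move=> j /negPf jl; rewrite !mxE [coord _ l _]coord_free.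
  by rewrite jl !mulr0.
exact: basis_free (vbasisP _).
Qed.

Lemma tens_ext (K : fieldType) (U V W : vectType K)
  (f g : 'Hom(tens U V, W)) :
  (forall u v, f (u ⊗ v) = g (u ⊗ v)) -> f = g.
Proof.
move=> fg; apply/lfunP=> t; rewrite (tens_span t) !linear_sum /=.
apply: eq_bigr => i _; rewrite !linear_sum /=; apply: eq_bigr => j _.
by rewrite !linearZ /= fg.
Qed.

Lemma tmapE (K : fieldType) (U V U' V' : vectType K)
  (f : {linear U -> U'}) (g : {linear V -> V'}) (u : U) (v : V) :
  tmap f g (u ⊗ v) = f u ⊗ g v.
Proof.
rewrite tliftE //; split=> [y a x x' | x a y y'] /=; rewrite linearP.
  exact: linearPl.
exact: linearPr.
Qed.

Lemma tauE (K : fieldType) (A : vectType K) (x y : A) :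
  tau A (x ⊗ y) = y ⊗ x.
Proof.
by rewrite tliftE //; split=> z a u v /=; rewrite ?linearPl ?linearPr.
Qed.

Lemma xiE (K : fieldType) (A : vectType K) (x y z : A) :
  xi A (x ⊗ y ⊗ z) = y ⊗ z ⊗ x.
Proof.
have lin w : bilinear_for (GRing.Scale.Law.clone _ _ *:%R _)
    (GRing.Scale.Law.clone _ _ *:%R _) (fun u v : A => (v ⊗ w ⊗ u : tens3 A)).
  by split=> [v a u u' | u a v v'] /=; rewrite ?linearPr ?linearPl.
rewrite tliftE; first by rewrite tliftE.
split=> [w a t t' | t a w w'] /=; first exact: linearP.
rewrite (tens_span t) !linear_sum /= -big_split /=.
apply: eq_bigr => i _; rewrite !linear_sum /= -big_split /=.
apply: eq_bigr => j _; rewrite !linearZ /= !tliftE // linearPr linearPl.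
by rewrite scalerDr scalerA mulrC -scalerA.
Qed.

Lemma Al_sum (K : fieldType) (A : vectType K) (br : {bilinear A -> A -> A})
  (n : nat) (u v : 'I_n -> A) :
  Al br (\sum_i u i ⊗ v i) =
  \sum_i \sum_j
    (br (u i) (u j) ⊗ v i ⊗ v j
     + u i ⊗ (br (u j) (v i) - br (v i) (u j)) ⊗ v j
     - u i ⊗ u j ⊗ br (v j) (v i)).
Proof.
have sumE (a : K) (x x' y y' z z' : tens3 A) :
    a *: x + x' + (a *: y + y') - (a *: z + z')
    = a *: (x + y - z) + (x' + y' - z').
  by rewrite scalerBr scalerDr opprD (addrACA (a *: x)) (addrACA (a *: x + _)).
have subE (a : K) (x x' y y' : A) :
    a *: x + x' - (a *: y + y') = a *: (x - y) + (x' - y').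
  by rewrite scalerBr opprD addrACA.
have lin_r x y : bilinear_for (GRing.Scale.Law.clone _ _ *:%R _)
    (GRing.Scale.Law.clone _ _ *:%R _) (Al_term br x y).
  by split=> [y' a z z' | z a y' y''] /=;
    rewrite /Al_term ?(linearPl, linearPr) /= ?subE ?(linearPl, linearPr) sumE.
have lin_l t : bilinear_for (GRing.Scale.Law.clone _ _ *:%R _)
    (GRing.Scale.Law.clone _ _ *:%R _)
    (fun u v : A => tlift (fun u' v' : A => Al_term br u v u' v') t).
  split=> [y a x x' | x a y y'] /=; rewrite (tens_span t) !linear_sum /=;
    rewrite -big_split /=; apply: eq_bigr => i _;
    rewrite !linear_sum /= -big_split /=; apply: eq_bigr => j _;
    rewrite !linearZ /= !tliftE // -scalerDr;
    congr (_ *: _);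
    by rewrite /Al_term ?(linearPl, linearPr) /= ?subE ?(linearPl, linearPr) sumE.
rewrite /Al linear_sum /=; apply: eq_bigr => i _; rewrite tliftE //.
by rewrite linear_sum /=; apply: eq_bigr => j _; rewrite tliftE.
Qed.

(* Main.v *)
Require Import Defs.
From HB Require Import structures.
From mathcomp Require Import all_boot all_order all_algebra.
Import GRing.Theory.
Local Open Scope ring_scope.

(** Write r as the sum of the u_i ⊗ v_i, ab for br a b, and <a, b> for
    ab - ba. Then delta_r x is the sum of the <u_i, x> ⊗ v_i - u_i ⊗ v_i x.
    Antisymmetry of r allows u_i and v_i to be exchanged in any sum bilinear
    in the pair (u_i, v_i), at the cost of a sign (antisym_sum_swap). The
    left-Alia axiom says <x, y>z + <y, z>x + <z, x>y = 0 (left_alia_comm).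

    Compatibility. The left-Alia axiom for x, y, u_i turns the argument of
    tau - id into (R(c) ⊗ 1 - 1 ⊗ R(c)) r + (R(y) ⊗ R(x) - R(x) ⊗ R(y)) r
    with c = <x, y> (delta_r_compatE). Both parts are symmetric because r is
    antisymmetric, so tau - id kills them.

    Coalgebra axiom. The operator alt = (id + xi + xi^2) (tau ⊗ id - id) is
    minus the antisymmetrizer of the three slots, so its arguments may be
    permuted up to sign. Expanding (delta ⊗ id) delta x, with u', v'
    for the second copy of r, gives the sum of
      alt(<u', <u, x>>, v', v) - alt(u', v'<u, x>, v)
      - alt(<u', u>, v', vx) + alt(u', v'u, vx).
    Exchanging u' and v' in the second term makes it cancel the part
    u'<u, x> of the first one; what remains, - alt(<u, x>u', v', v), equals
    alt((u'u)x, v', v) by the left-Alia axiom (alt_comm_br). Exchanging u and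
    v in the last two terms turns the total into
      alt((u'u)x, v', v) + alt(ux, <u', v>, v') - alt(ux, u', v'v),
    which is the image of Al(r) under alt after R(x) acts on the first slot
    (Al_Rmul), hence zero. *)

(** * Tensors as sums of pure tensors *)

Notation bilinear_map f := (bilinear_for (GRing.Scale.Law.clone _ _ *:%R _)
  (GRing.Scale.Law.clone _ _ *:%R _) f).

Lemma tens_sum_pure {K : fieldType} {U V : vectType K} (t : tens U V) :
  exists n (u : 'I_n -> U) (v : 'I_n -> V), t = \sum_i u i ⊗ v i.
Proof.
exists (\dim {:U}), (fun i => (vbasis {:U})`_i).
exists (fun i => \sum_j t i j *: (vbasis {:V})`_j).
rewrite [LHS]tens_span; apply: eq_bigr => i _.
by rewrite linear_sumr; apply: eq_bigr => j _; rewrite linearZr_LR.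
Qed.

Lemma tau_tmap {K : fieldType} {A : vectType K} (f g : 'End(A))
  (t : tens A A) : tau A (tmap f g t) = tmap g f (tau A t).
Proof.
have [n [u [v ->]]] := tens_sum_pure t.
rewrite !linear_sum; apply: eq_bigr => i _.
by rewrite /= !tmapE !tauE tmapE.
Qed.

(** The two sides are the values at r and at - tau r of the linear map
    induced by F. *)
Lemma antisym_sum_swap {K : fieldType} {A W : vectType K} {n : nat}
  (u v : 'I_n -> A) (F : A -> A -> W) :
  bilinear_map F ->
  \sum_i u i ⊗ v i + tau A (\sum_i u i ⊗ v i) = 0 ->
  \sum_i F (u i) (v i) = - \sum_i F (v i) (u i).
Proof.
move=> F_lin /eqP; rewrite addr_eq0 => /eqP /(congr1 (tlift F)).
rewrite linearN !linear_sum /= => F_swap.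
under eq_bigr do rewrite -tliftE //.
by rewrite F_swap; apply: eq_bigr => i _; rewrite tauE tliftE.
Qed.

Lemma sub_lfunE {K : fieldType} {U V : vectType K} (f g : 'Hom(U, V)) x :
  (f - g) x = f x - g x.
Proof. by rewrite add_lfunE opp_lfunE. Qed.

(** * The cobracket of r *)

Section LeftAlia.
Context {K : fieldType} {A : vectType K} (br : {bilinear A -> A -> A}).
Local Notation comm a b := (br a b - br b a).

Lemma RmulE x y : Rmul br x y = br y x.
Proof. exact: (lfunE (applyr br x) y). Qed.

Lemma LmulE x y : Lmul br x y = br x y.
Proof. exact: (lfunE (br x) y). Qed.

Lemma delta_r_sum {n : nat} (u v : 'I_n -> A) (x : A) :
  delta_r br (\sum_i u i ⊗ v i) x
  = \sum_i (comm (u i) x ⊗ v i - u i ⊗ br (v i) x).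
Proof.
rewrite [LHS]sub_lfunE !linear_sum -big_split; apply: eq_bigr => i _ /=.
by rewrite !tmapE /= sub_lfunE !RmulE LmulE.
Qed.

Lemma comm_linearr z : linear (fun x => comm z x).
Proof.
by move=> a x y /=; rewrite linearPr linearPl /= scalerBr opprD addrACA.
Qed.

Lemma delta_r_linear (r : tens A A) : linear (delta_r br r).
Proof.
move=> a x y; have [n [u [v ->]]] := tens_sum_pure r.
rewrite !delta_r_sum scaler_sumr -big_split; apply: eq_bigr => i _ /=.
rewrite comm_linearr.
by rewrite !linearPr linearPl /= opprD addrACA scalerBr.
Qed.

(** The form in which the left-Alia axiom is used: the bracket of a commutator
    satisfies a Jacobi-like identity. *)
Lemma left_alia_comm : left_alia_algebra br -> forall x y z,
  br (comm x y) z + br (comm y z) x + br (comm z x) y = 0.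
Proof.
move=> Halg x y z; rewrite !linearBl /=.
rewrite [X in X + _]addrACA -opprD addrACA -opprD Halg.
by apply/eqP; rewrite subr_eq0; apply/eqP; rewrite (addrAC (br (br y x) z)).
Qed.

(** * Compatibility *)

(** By the left-Alia axiom for x, y and u i, the iterated brackets cancel in
    the first factor of each summand, except u i times the commutator of x and
    y. What remains is a sum of differences tmap f g r - tmap g f r, which tau
    fixes when tau r = - r. *)
Lemma delta_r_compatE (r : tens A A) (x y : A) :
  left_alia_algebra br ->
  delta_r br r (comm x y) + tmap (Rmul br x) (@idfun A) (delta_r br r y)
    - tmap (Rmul br y) (@idfun A) (delta_r br r x)
  = tmap (Rmul br (comm x y)) (\1%VF) r - tmap (\1%VF) (Rmul br (comm x y)) r
    + (tmap (Rmul br y) (Rmul br x) r - tmap (Rmul br x) (Rmul br y) r).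
Proof.
move=> /left_alia_comm Hcomm; have [n [u [v ->]]] := tens_sum_pure r.
rewrite !delta_r_sum !linear_sum -!big_split /=.
apply: eq_bigr => i _.
have Hc : br (comm x y) (u i) = br (comm (u i) y) x - br (comm (u i) x) y.
  apply/eqP; rewrite -subr_eq0 opprB addrCA addrA.
  by rewrite -[X in _ + X]linearNl /= opprB Hcomm.
move: (comm x y) Hc => c Hc.
rewrite !linearB /= !tmapE /= !RmulE !id_lfunE Hc !linearBl /= -addrA.
rewrite [X in _ + X]addrACA opprK (addrC (- _) (br (u i) y ⊗ _)).
by rewrite (addrAC _ _ (- (u i ⊗ _))) subrKA.
Qed.

Lemma delta_r_compat (r : tens A A) (x y : A) :
  left_alia_algebra br -> r + tau A r = 0 ->
  (tau A - \1)%VF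
    (delta_r br r (comm x y) + tmap (Rmul br x) (@idfun A) (delta_r br r y)
     - tmap (Rmul br y) (@idfun A) (delta_r br r x)) = 0.
Proof.
move=> Halg /eqP; rewrite addrC addr_eq0 => /eqP tau_r.
rewrite [LHS]sub_lfunE id_lfunE delta_r_compatE //.
apply/eqP; rewrite subr_eq0; apply/eqP.
rewrite !linearD !linearN /= !tau_tmap tau_r !linearN /= !opprK.
by rewrite [in LHS](addrC (- _)) [X in _ + X = _]addrC.
Qed.

(** * The antisymmetrizer of three slots *)

Definition cyc : 'End(tens3 A) := (\1 + xi A + (xi A \o xi A))%VF.

(** Minus the sum of the signed permutations of the slots: tau ⊗ id - id is
    kept as a factor so that this is literally the operator of the coalgebra
    axiom. *)
Definition alt3 : 'End(tens3 A) := (cyc \o (tmap (tau A) (@idfun A) - \1))%VF.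

Local Notation alt p q s := (alt3 (p ⊗ q ⊗ s)).

Lemma cycE p q s : cyc (p ⊗ q ⊗ s) = p ⊗ q ⊗ s + q ⊗ s ⊗ p + s ⊗ p ⊗ q.
Proof. by rewrite !add_lfunE comp_lfunE id_lfunE !xiE. Qed.

Lemma cyc_rot p q s : cyc (q ⊗ s ⊗ p) = cyc (p ⊗ q ⊗ s).
Proof. by rewrite !cycE addrC addrA. Qed.

Lemma altE p q s : alt p q s = cyc (q ⊗ p ⊗ s) - cyc (p ⊗ q ⊗ s).
Proof.
by rewrite comp_lfunE [X in cyc X]sub_lfunE id_lfunE linearB /= tmapE /= tauE.
Qed.

Lemma alt_rot p q s : alt q s p = alt p q s.
Proof. by rewrite !altE (cyc_rot p q s) -(cyc_rot q p s) -(cyc_rot p s q). Qed.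

Lemma alt_swap p q s : alt q p s = - alt p q s.
Proof. by rewrite !altE opprB. Qed.

Lemma tmap_delta_rE (r : tens A A) (a b : A) :
  tmap (delta_r br r) (@idfun A) (a ⊗ b) = delta_r br r a ⊗ b.
Proof.
pose dL := GRing.isLinear.Build K A (tens A A) *:%R _ (delta_r_linear r).
pose d : {linear A -> tens A A} := HB.pack (delta_r br r) dL.
exact: (tmapE d idfun).
Qed.

(** * The coalgebra axiom *)

(** The Yang-Baxter equation enters only here: Al(r) = 0 is multiplied by x on
    the right in its first slot, then antisymmetrized. *)
Lemma Al_Rmul {n : nat} (u v : 'I_n -> A) (x : A) :
  Al br (\sum_i u i ⊗ v i) = 0 ->
  \sum_i \sum_j (alt (br (br (u i) (u j)) x) (v i) (v j)
    + alt (br (u i) x) (comm (u j) (v i)) (v j)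
    - alt (br (u i) x) (u j) (br (v j) (v i))) = 0.
Proof.
rewrite Al_sum => /(congr1 (tmap (tmap (Rmul br x) (@idfun A)) (@idfun A))).
move=> /(congr1 alt3); rewrite !linear0 => Al0; rewrite -[RHS]Al0.
rewrite !linear_sum; apply: eq_bigr => i _.
rewrite !linear_sum; apply: eq_bigr => j _ /=.
by rewrite !(linearB, linearD) /= !tmapE /= !tmapE /= !RmulE.
Qed.

(** Exchanging the two copies of r reverses the last two slots, so that below
    alt only the part of the first slot that is antisymmetric in (u i, u j)
    matters. For both sides this part is given by the left-Alia axiom for
    u i, u j and x. *)
Lemma alt_comm_br {n : nat} (u v : 'I_n -> A) (x : A) :
  left_alia_algebra br ->
  \sum_i \sum_j alt (br (comm (u i) x) (u j)) (v j) (v i)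
  = - \sum_i \sum_j alt (br (br (u j) (u i)) x) (v j) (v i).
Proof.
move=> /left_alia_comm Hcomm.
have altC p q s : alt p q s = cyc (p ⊗ s ⊗ q) - cyc (p ⊗ q ⊗ s).
  by rewrite altE -(cyc_rot q p s).
(* Half of the terms are reindexed by exchanging the two copies of r. *)
have alt_sum (f : A -> A -> A) :
    \sum_i \sum_j alt (f (u i) (u j)) (v j) (v i)
    = \sum_i \sum_j cyc ((f (u j) (u i) - f (u i) (u j)) ⊗ v j ⊗ v i).
  transitivity (\sum_i \sum_j cyc (f (u i) (u j) ⊗ v i ⊗ v j)
      - \sum_i \sum_j cyc (f (u i) (u j) ⊗ v j ⊗ v i)).
    rewrite -sumrB; apply: eq_bigr => i _; rewrite -sumrB.
    by apply: eq_bigr => j _; rewrite altC.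
  rewrite exchange_big /= -sumrB; apply: eq_bigr => i _; rewrite -sumrB.
  by apply: eq_bigr => j _; rewrite !linearBl linearB.
rewrite (alt_sum (fun a b => br (comm a x) b)).
rewrite (alt_sum (fun a b => br (br b a) x)).
rewrite -sumrN; apply: eq_bigr => i _; rewrite -sumrN; apply: eq_bigr => j _.
have -> : br (comm (u j) x) (u i) - br (comm (u i) x) (u j)
    = - (br (br (u i) (u j)) x - br (br (u j) (u i)) x).
  apply/eqP; rewrite -addr_eq0 addrC addrA -linearBl /=.
  by rewrite -[X in _ + X]linearNl /= opprB Hcomm.
by rewrite !linearNl linearN.
Qed.

Section Antisymmetric.
Context {n : nat} (u v : 'I_n -> A).
Context (r_anti : \sum_i u i ⊗ v i + tau A (\sum_i u i ⊗ v i) = 0).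

Let swap (F : A -> A -> tens3 A) : bilinear_map F ->
  \sum_i F (u i) (v i) = - \sum_i F (v i) (u i).
Proof. by move=> F_lin; apply: antisym_sum_swap. Qed.

Lemma alt_br_second w s :
  \sum_j alt (u j) (br (v j) w) s = \sum_j alt (br (u j) w) (v j) s.
Proof.
rewrite (@swap (fun a b => alt a (br b w) s)).
  by rewrite -sumrN; apply: eq_bigr => j _; rewrite alt_swap opprK.
by split=> [z c p q|z c p q] /=; rewrite !(linearPl, linearPr) /= linearP.
Qed.

(** Here and in alt_br_third, exchanging u and v and then rotating the slots
    gives the term the shape of a term of Al(r). *)
Lemma alt_comm_third a b x :
  \sum_i alt (comm a (u i)) b (br (v i) x)
  = - \sum_i alt (br (u i) x) (comm a (v i)) b.
Proof.
rewrite (@swap (fun p q => alt (comm a p) b (br q x))).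
  by congr (- _); apply: eq_bigr => i _; rewrite alt_rot.
by split=> [z c p q|z c p q] /=;
  rewrite ?comm_linearr !(linearPl, linearPr) /= linearP.
Qed.

Lemma alt_br_third a b x :
  \sum_i alt a (br b (u i)) (br (v i) x)
  = - \sum_i alt (br (u i) x) a (br b (v i)).
Proof.
rewrite (@swap (fun p q => alt a (br b p) (br q x))).
  by congr (- _); apply: eq_bigr => i _; rewrite alt_rot.
by split=> [z c p q|z c p q] /=; rewrite !(linearPl, linearPr) /= linearP.
Qed.

Lemma alt_delta_r_sum x :
  alt3 (tmap (delta_r br (\sum_i u i ⊗ v i)) (@idfun A)
          (delta_r br (\sum_i u i ⊗ v i) x))
  = \sum_i \sum_j (alt (comm (u j) (comm (u i) x)) (v j) (v i)
      - alt (u j) (br (v j) (comm (u i) x)) (v i)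
      - (alt (comm (u j) (u i)) (v j) (br (v i) x)
         - alt (u j) (br (v j) (u i)) (br (v i) x))).
Proof.
rewrite [X in tmap _ _ X]delta_r_sum !linear_sum; apply: eq_bigr => i _ /=.
rewrite !linearB /= !tmap_delta_rE !delta_r_sum !linear_sumlz !linear_sum.
rewrite -big_split; apply: eq_bigr => j _ /=.
by rewrite -!linearB /= -!linearBl.
Qed.

Lemma delta_r_coalgebra x :
  left_alia_algebra br -> Al br (\sum_i u i ⊗ v i) = 0 ->
  alt3 (tmap (delta_r br (\sum_i u i ⊗ v i)) (@idfun A)
          (delta_r br (\sum_i u i ⊗ v i) x)) = 0.
Proof.
move=> Halg HAl; rewrite alt_delta_r_sum.
(* The second term cancels half of the first commutator. *)
transitivity (- \sum_i \sum_j alt (br (comm (u i) x) (u j)) (v j) (v i)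
    - \sum_i \sum_j alt (comm (u j) (u i)) (v j) (br (v i) x)
    + \sum_i \sum_j alt (u j) (br (v j) (u i)) (br (v i) x)).
  rewrite -!sumrN -!big_split /=; apply: eq_bigr => i _.
  rewrite !sumrB alt_br_second opprB [X in _ + X]addrC addrA.
  congr (_ - _ + _); rewrite -sumrB -sumrN; apply: eq_bigr => j _.
  by rewrite !linearBl linearB /= addrAC subrr add0r.
rewrite alt_comm_br // opprK.
rewrite (exchange_big _ _ _ _ _ (fun i j => alt (comm _ _) _ _)) /=.
(* The copy carrying x is summed first, so that it can be exchanged. *)
rewrite [X in _ + X = _]exchange_big /=.
under [X in _ - X + _]eq_bigr do rewrite alt_comm_third.
under [X in _ + X = _]eq_bigr do rewrite alt_br_third.
rewrite !sumrN opprK -[RHS](Al_Rmul _ _ x HAl) [RHS]exchange_big /=.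
rewrite -big_split -sumrB; apply: eq_bigr => j _.
by rewrite -big_split -sumrB.
Qed.

End Antisymmetric.
End LeftAlia.

Theorem corollary4p3 (K : closedFieldType) (K0 : [pchar K] =i pred0)
  (A : vectType K) (br : {bilinear A -> A -> A})
  (Halg : left_alia_algebra br) (r : tens A A)
  (Hanti : r + tau A r = 0) (HAl : Al br r = 0) :
  left_alia_bialgebra br (delta_r br r).
Proof.
split=> //; last by move=> x y; apply: delta_r_compat.
split=> [|x]; first exact: delta_r_linear.
have [n [u [v r_sum]]] := tens_sum_pure r.
rewrite r_sum in Hanti HAl *; rewrite [LHS]comp_lfunE.
exact: delta_r_coalgebra.
Qed.
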